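(* Let $c<d$ be real numbers and let $f:[c,d]\to\mathbb{R}$ be a continuous function. Consider the problem of best Chebyshev (uniform) approximation of $f$ on $[c,d]$ by linear splines with one free internal knot: $$\text{minimise}\quad \sup_{t\in[c,d]}\left|a_0+a_1\max\{0,t-c\}+a_2\max\{0,t-\theta\}-f(t)\right|\quad\text{over } (a_0,a_1,a_2,\theta)\in\mathbb{R}^4 \text{ with } c\le\theta\le d.$$ Let $s(t)=a_0+a_1\max\{0,t-c\}+a_2\max\{0,t-\theta\}$ with $c\le\theta\le d$ be a linear spline with one internal knot $\theta$. Each of the following two conditions is sufficient for $s$ to be optimal, i.e. to be a global minimiser of this problem: 1. $s$ consists of two distinct linear pieces (the affine functions representing $s$ on $[c,\theta]$ and on $[\theta,d]$ are different), and there are at least three alternating points in each of the subintervals $[c,\theta]$ and $[\theta,d]$. 2. $s$ consists of a single linear piece (that is, $s$ is one affine function on all of $[c,d]$), and there are at least four alternating points in the whole interval $[c,d]$.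
   Context: A linear spline with one internal knot on $[c,d]$ is a continuous piecewise affine function with at most two affine pieces, the pieces joining at the internal knot $\theta$; the endpoints $c,d$ are the fixed external knots. The knot is ''free'': $\theta$ is a decision variable together with the coefficients $a_0,a_1,a_2$. Alternating points: for an approximation $s$ of $f$ on $[c,d]$, points $t_1<t_2<\dots<t_k$ in $[c,d]$ are alternating points if the absolute deviation is maximal at each of them, $|f(t_i)-s(t_i)|=\max_{t\in[c,d]}|f(t)-s(t)|$ for $i=1,\dots,k$, and the signs of the deviation alternate, $f(t_{i+1})-s(t_{i+1})=-(f(t_i)-s(t_i))$ for $i=1,\dots,k-1$. Saying that a subinterval has at least $k$ alternating points means that such a sequence of $k$ points exists inside that (closed) subinterval; the knot $\theta$ belongs to both subintervals $[c,\theta]$ and $[\theta,d]$ and may be used as an alternating point in each of them. *)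

(* Defs.v *)
From HB Require Import structures.
From mathcomp Require Import all_boot all_order all_algebra.
From mathcomp Require Import all_classical all_reals all_analysis.
Set Implicit Arguments.
Unset Strict Implicit.
Unset Printing Implicit Defensive.
Import Order.TTheory GRing.Theory Num.Theory.
Import numFieldNormedType.Exports.
Local Open Scope classical_set_scope.
Local Open Scope ring_scope.

Definition spline (R : realType) (c a0 a1 a2 theta : R) (t : R) : R :=
  a0 + a1 * Num.max 0 (t - c) + a2 * Num.max 0 (t - theta).

(* The real-valued [sup] is junk (0) on unbounded sets; it is only used here
   for s and f continuous on [c, d], where the set is nonempty and bounded. *)
Definition uniform_deviation (R : realType) (c d : R) (f s : R -> R) : R :=
  sup [set `|s t - f t| | t in `[c, d]].

Definition optimal_spline (R : realType) (c d : R) (f : R -> R)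
    (a0 a1 a2 theta : R) : Prop :=
  forall b0 b1 b2 tau : R, c <= tau <= d ->
    uniform_deviation c d f (spline c a0 a1 a2 theta) <=
    uniform_deviation c d f (spline c b0 b1 b2 tau).

(* The deviation is maximal over the whole of [c, d], whereas the points
   themselves are only required to lie in the subinterval [u, v]. *)
Definition alternating_points (R : realType) (c d : R) (f s : R -> R)
    (u v : R) (ts : seq R) : Prop :=
  [/\ sorted <%R ts,
      forall t, t \in ts -> u <= t <= v,
      forall t, t \in ts ->
        forall x, c <= x <= d -> `|f x - s x| <= `|f t - s t| &
      forall i, (i.+1 < size ts)%N ->
        f ts`_i.+1 - s ts`_i.+1 = - (f ts`_i - s ts`_i)].

Definition has_alternating_points (R : realType) (c d : R) (f s : R -> R)
    (u v : R) (k : nat) : Prop :=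
  exists ts : seq R, size ts = k /\ alternating_points c d f s u v ts.

Definition affine_fun (R : realType) (p : R -> R) : Prop :=
  exists m b : R, forall t, p t = m * t + b.

Definition single_piece (R : realType) (c d : R) (s : R -> R) : Prop :=
  exists p : R -> R, affine_fun p /\ (forall t, c <= t <= d -> s t = p t).

(* For theta = c or theta = d one of the two subintervals is a single point and
   this holds for every spline; three distinct points then cannot lie in that
   subinterval, so such knots never occur together with the alternation
   condition. *)
Definition two_distinct_pieces (R : realType) (c d theta : R) (s : R -> R) :
    Prop :=
  exists p q : R -> R,
    [/\ affine_fun p, affine_fun q,
        forall t, c <= t <= theta -> s t = p t,
        forall t, theta <= t <= d -> s t = q t &
        p <> q].

(* Main.v *)
Require Import Defs.
From HB Require Import structures.
From mathcomp Require Import all_boot all_order all_algebra.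
From mathcomp Require Import all_classical all_reals all_analysis.
From mathcomp Require Import ring lra.
Set Implicit Arguments.
Unset Strict Implicit.
Unset Printing Implicit Defensive.
Import Order.TTheory GRing.Theory Num.Theory.
Import numFieldNormedType.Exports.
Local Open Scope classical_set_scope.
Local Open Scope ring_scope.

(** Suppose that a spline [s'] had a smaller uniform deviation from [f] than
    [s].  At a point where [|f - s|] is maximal, [f - s'] is smaller in absolute
    value than [f - s], so [g := s' - s] has there the sign of [f - s]
    ([improvement_sign]): [g] changes sign between consecutive alternating
    points.

    Sign changes are limited by convexity, measured by the three-point second
    difference [second_diff g x y z], which is linear in [g], vanishes on affine
    functions and is nonnegative on hinges [max 0 (t - tau)].  If [g] changes
    sign from [x] to [y] and from [y] to [z], then [second_diff g x y z] is
    nonzero, of the sign opposite to that of [g y]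
    ([second_diff_sign_changes]).

    If [s] has two pieces meeting at [theta], the knot [tau] of [s'] lies on one
    side of [theta], so on the subinterval on the other side [s] and [s'] are
    both affine; there [g] has second difference zero, which three alternating
    points forbid.  If [s] is affine on [c, d], the second differences of [g]
    are nonnegative multiples of a single number, the slope jump of [s'], so no
    two of them have opposite signs; but the first three and the last three of
    four alternating points yield exactly that. *)

Section SecondDifference.
Variable R : realType.
Implicit Types (g h p : R -> R) (x y z tau : R).

(** [second_diff g x y z] is [(z - x) * (y - x) * (z - y)] times the divided
    difference of [g] at the three points; clearing the denominators leaves an
    expression defined for coinciding points too. *)
Definition second_diff g x y z : R :=
  (z - y) * g x + (y - x) * g z - (z - x) * g y.

Definition hinge tau : R -> R := fun t => Num.max 0 (t - tau).

Lemma second_diffB g h x y z :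
  second_diff (fun t => g t - h t) x y z =
  second_diff g x y z - second_diff h x y z.
Proof. by rewrite /second_diff; ring. Qed.

Lemma second_diff_affine g p x y z : affine_fun p ->
  g x = p x -> g y = p y -> g z = p z -> second_diff g x y z = 0.
Proof.
by move=> [m [b pE]] gx gy gz; rewrite /second_diff gx gy gz !pE; ring.
Qed.

(** This is the convexity of the hinge. *)
Lemma second_diff_hinge_ge0 tau x y z : x <= y -> y <= z ->
  0 <= second_diff (hinge tau) x y z.
Proof.
move=> xy yz; rewrite /second_diff /hinge.
have hx : 0 <= Num.max 0 (x - tau) by rewrite le_max lexx.
have hz : 0 <= Num.max 0 (z - tau) by rewrite le_max lexx.
have hx' : x - tau <= Num.max 0 (x - tau) by rewrite le_max lexx orbT.
have hz' : z - tau <= Num.max 0 (z - tau) by rewrite le_max lexx orbT.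
by case: (leP 0 (y - tau)) => hy; nra.
Qed.

Lemma second_diff_hinge_left tau x y z : x <= y -> y <= z -> z <= tau ->
  second_diff (hinge tau) x y z = 0.
Proof.
move=> xy yz zt; rewrite /second_diff /hinge !max_l ?subr_le0 //.
- by ring.
- exact: le_trans zt.
- by apply: le_trans zt; apply: le_trans yz.
Qed.

Lemma second_diff_hinge_right tau x y z : x <= y -> y <= z -> tau <= x ->
  second_diff (hinge tau) x y z = 0.
Proof.
move=> xy yz tx; rewrite /second_diff /hinge !max_r ?subr_ge0 //.
- by ring.
- exact: le_trans xy.
- by apply: le_trans yz; apply: le_trans xy.
Qed.

Lemma second_diff_spline c a0 a1 a2 tau x y z : c <= x -> x <= y -> y <= z ->
  second_diff (spline c a0 a1 a2 tau) x y z =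
  a2 * second_diff (hinge tau) x y z.
Proof.
move=> cx xy yz.
have -> : second_diff (spline c a0 a1 a2 tau) x y z =
    a1 * second_diff (hinge c) x y z + a2 * second_diff (hinge tau) x y z.
  by rewrite /second_diff /spline /hinge; ring.
by rewrite [X in a1 * X]second_diff_hinge_right // mulr0 add0r.
Qed.

(** All three terms of [second_diff g x y z] have the sign opposite to that of
    [g y]. *)
Lemma second_diff_sign_changes g x y z : x < y -> y < z ->
  g x * g y < 0 -> g y * g z < 0 -> second_diff g x y z * g y < 0.
Proof.
move=> xy yz gxy gyz; rewrite /second_diff.
have -> : ((z - y) * g x + (y - x) * g z - (z - x) * g y) * g y =
  (z - y) * (g x * g y) + (y - x) * (g y * g z) - (z - x) * g y ^+ 2 by ring.
have := sqr_ge0 (g y); nra.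
Qed.

End SecondDifference.

Section Improvement.
Context {R : realType}.
Implicit Types (c d u v : R) (f s : R -> R).

Lemma continuous_spline c a0 a1 a2 tau : continuous (spline c a0 a1 a2 tau : R -> R).
Proof.
have hinge_cont b : continuous (hinge b).
  have -> : hinge b = cst 0 \max (fun x => x - b) by [].
  move=> t; apply: continuous_max; first exact: cst_continuous.
  by apply: cvgB; [exact: cvg_id | exact: cvg_cst].
move=> t; apply: cvgD; last by apply: cvgM; [exact: cvg_cst | exact: hinge_cont].
by apply: cvgD; [exact: cvg_cst | apply: cvgM; [exact: cvg_cst | exact: hinge_cont]].
Qed.

(** Continuity makes the set of deviations bounded, so that its supremum is a
    genuine upper bound. *)
Lemma le_uniform_deviation c d f s t : {within `[c, d], continuous f} ->
  continuous s -> c <= t <= d -> `|s t - f t| <= uniform_deviation c d f s.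
Proof.
move=> fc sc tcd; have cd : c <= d by case/andP: tcd; exact: le_trans.
have dev_cont : {within `[c, d], continuous (fun x => `|s x - f x|)}.
  move=> x; apply: cvg_norm; apply: cvgB; last exact: fc.
  exact: (continuous_subspaceT sc).
have [m _ m_max] := EVT_max cd dev_cont.
apply: sup_ubound; last by exists t; rewrite //= in_itv.
by exists `|s m - f m| => _ [x xcd <-]; exact: m_max.
Qed.

Lemma uniform_deviation_le c d f s e : c <= d ->
  (forall t, c <= t <= d -> `|s t - f t| <= e) -> uniform_deviation c d f s <= e.
Proof.
move=> cd dev_le; apply: ge_sup.
  by exists `|s c - f c|, c; rewrite //= in_itv/= lexx.
by move=> _ [t + <-]; rewrite /= in_itv; exact: dev_le.
Qed.

(** The value [s' t] is closer to [f t] than [s t] is, hence on the same side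
    of [s t] as [f t]. *)
Lemma improvement_sign {c d f s s' t} : {within `[c, d], continuous f} ->
  continuous s' -> uniform_deviation c d f s' < uniform_deviation c d f s ->
  c <= t <= d ->
  (forall x, c <= x <= d -> `|f x - s x| <= `|f t - s t|) ->
  0 < (s' t - s t) * (f t - s t).
Proof.
move=> fc sc' better tcd t_max.
have cd : c <= d by case/andP: tcd; exact: le_trans.
have : `|s' t - f t| < `|f t - s t|.
  apply: (le_lt_trans (le_uniform_deviation fc sc' tcd)).
  apply: (lt_le_trans better); apply: uniform_deviation_le => // x xcd.
  by rewrite distrC; exact: t_max.
rewrite ltr_norml; case: (ger0P (f t - s t)) => _ /andP[lo hi].
  by apply: mulr_gt0; lra.
by rewrite nmulr_rgt0; lra.
Qed.

Lemma improvement_sign_changes {c d f s s' u v ts} :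
  {within `[c, d], continuous f} ->
  continuous s' -> uniform_deviation c d f s' < uniform_deviation c d f s ->
  c <= u -> v <= d -> alternating_points c d f s u v ts ->
  forall i, (i.+1 < size ts)%N ->
    (s' ts`_i - s ts`_i) * (s' ts`_i.+1 - s ts`_i.+1) < 0.
Proof.
move=> fc sc' better cu vd [_ ts_uv ts_max ts_alt] i i_lt.
have sign t : t \in ts -> 0 < (s' t - s t) * (f t - s t).
  move=> tin; apply: (improvement_sign fc sc' better _ (ts_max t tin)).
  by have /andP[ut tv] := ts_uv t tin; rewrite (le_trans cu ut) (le_trans tv vd).
have := sign _ (mem_nth 0 i_lt); have := sign _ (mem_nth 0 (ltnW i_lt)).
rewrite ts_alt // ; move: (f ts`_i - s ts`_i) => r.
move: (s' ts`_i - s ts`_i) (s' ts`_i.+1 - s ts`_i.+1) => g h.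
by case: (ltgtP r 0) => [r_lt0|r_gt0|->]; nra.
Qed.

(** If [s'] were better, then [s' - s] would change sign twice along the three
    points, and its second difference there would be nonzero. *)
Lemma three_alternating_points_no_improvement {c d f s s' u v} :
  {within `[c, d], continuous f} -> continuous s' -> c <= u -> v <= d ->
  has_alternating_points c d f s u v 3 ->
  (forall x y z, u <= x -> x <= y -> y <= z -> z <= v ->
     second_diff (fun t => s' t - s t) x y z = 0) ->
  uniform_deviation c d f s <= uniform_deviation c d f s'.
Proof.
move=> fc sc' cu vd [ts [ts3 alt]] flat.
case: ts ts3 alt => [|x [|y [|z []]]] //= _ alt.
rewrite leNgt; apply/negP => better.
have chg := improvement_sign_changes fc sc' better cu vd alt.
case: alt => + uv _ _ => /= /and3P[xy yz _].
have /andP[ux _] : u <= x <= v by apply: uv; rewrite !inE eqxx.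
have /andP[_ zv] : u <= z <= v by apply: uv; rewrite !inE eqxx !orbT.
have := second_diff_sign_changes (g := fun t => s' t - s t) xy yz
  (chg 0%N isT) (chg 1%N isT).
by rewrite flat ?mul0r ?ltxx // ltW.
Qed.

(** If [s'] were better, then the first three and the last three of the points
    would give second differences of [s' - s] with opposite signs, because
    [s' - s] has opposite signs at the two middle points. *)
Lemma four_alternating_points_no_improvement {c d f s s'} :
  {within `[c, d], continuous f} -> continuous s' ->
  has_alternating_points c d f s c d 4 ->
  (forall x y z w, c <= x -> x <= y -> y <= z -> z <= w -> w <= d ->
     0 <= second_diff (fun t => s' t - s t) x y z *
          second_diff (fun t => s' t - s t) y z w) ->
  uniform_deviation c d f s <= uniform_deviation c d f s'.
Proof.
move=> fc sc' [ts [ts4 alt]] same_sign.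
case: ts ts4 alt => [|x [|y [|z [|w []]]]] //= _ alt.
rewrite leNgt; apply/negP => better.
have chg := improvement_sign_changes fc sc' better (lexx c) (lexx d) alt.
case: alt => + uv _ _ => /= /and4P[xy yz zw _].
have /andP[cx _] : c <= x <= d by apply: uv; rewrite !inE eqxx.
have /andP[_ wd] : c <= w <= d by apply: uv; rewrite !inE eqxx !orbT.
have := same_sign _ _ _ _ cx (ltW xy) (ltW yz) (ltW zw) wd.
have := second_diff_sign_changes (g := fun t => s' t - s t) xy yz
  (chg 0%N isT) (chg 1%N isT).
have := second_diff_sign_changes (g := fun t => s' t - s t) yz zw
  (chg 1%N isT) (chg 2%N isT).
have /= := chg 1%N isT.
move: (second_diff _ x y z) (second_diff _ y z w) => D1 D2.
move: (s' y - s y) (s' z - s z) => gy gz gyz D2z D1y.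
rewrite leNgt => /negP; apply.
have : 0 < (D1 * gy) * (D2 * gz) by rewrite nmulr_rgt0.
by rewrite mulrACA nmulr_lgt0.
Qed.

End Improvement.

Theorem theorem4p1 (R : realType) (c d : R) (f : R -> R)
    (a0 a1 a2 theta : R) (hcd : c < d)
    (hf : {within `[c, d], continuous f}) (htheta : c <= theta <= d) :
  (two_distinct_pieces c d theta (spline c a0 a1 a2 theta) ->
   has_alternating_points c d f (spline c a0 a1 a2 theta) c theta 3 ->
   has_alternating_points c d f (spline c a0 a1 a2 theta) theta d 3 ->
   optimal_spline c d f a0 a1 a2 theta)
  /\
  (single_piece c d (spline c a0 a1 a2 theta) ->
   has_alternating_points c d f (spline c a0 a1 a2 theta) c d 4 ->
   optimal_spline c d f a0 a1 a2 theta).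
Proof.
have /andP[ctheta thetad] := htheta.
split=> [_ altl altr | [p [p_aff sp]] alt] b0 b1 b2 tau _.
- have sc' := @continuous_spline R c b0 b1 b2 tau.
  case: (leP theta tau) => [theta_tau|/ltW tau_theta].
  + apply: (three_alternating_points_no_improvement hf sc' (lexx c) thetad altl).
    move=> x y z cx xy yz ztheta.
    rewrite second_diffB !second_diff_spline // !second_diff_hinge_left //.
      by rewrite !mulr0 subrr.
    exact: le_trans theta_tau.
  + apply: (three_alternating_points_no_improvement hf sc' ctheta (lexx d) altr).
    move=> x y z thetax xy yz zd.
    have cx := le_trans ctheta thetax.
    rewrite second_diffB !second_diff_spline // !second_diff_hinge_right //.
      by rewrite !mulr0 subrr.
    exact: le_trans thetax.
- have sc' := @continuous_spline R c b0 b1 b2 tau.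
  apply: (four_alternating_points_no_improvement hf sc' alt).
  have diffE x y z : c <= x -> x <= y -> y <= z -> z <= d ->
      second_diff (fun t => spline c b0 b1 b2 tau t - spline c a0 a1 a2 theta t)
        x y z = b2 * second_diff (hinge tau) x y z.
    move=> cx xy yz zd; rewrite second_diffB second_diff_spline //.
    rewrite [X in _ - X](second_diff_affine p_aff) ?subr0 //; apply: sp; lra.
  move=> x y z w cx xy yz zw wd.
  rewrite !diffE ?(le_trans cx xy) ?(le_trans zw wd) //.
  by rewrite mulrACA -expr2 mulr_ge0 ?sqr_ge0 ?mulr_ge0 ?second_diff_hinge_ge0.
Qed.
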